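(* For any $n\ge1$ and $N\ge3$, there exists an instance of the dual DRO problem $$\max_{\mathbb Q\in\mathcal P}\min_{x\in\mathcal X}\mathbb E_{z\sim\mathbb Q}[\ell(x,z)]$$ (with decision dimension $n$, $N$ empirical samples, and some number $K$ of loss components) satisfying the regularity assumption of the context, such that any optimal least-favorable distribution (maximizer) $\mathbb Q^\star_{\mathrm{dual}}$ requires a support of at least $\min\{N+n+1,KN\}$ distinct atoms.
   Context: Notation: $[n]=\{1,\dots,n\}$; $\mathcal P(\mathcal Z)$ is the set of Borel probability measures on $\mathcal Z$. An instance consists of sets $\mathcal X\subseteq\mathbb R^n$, $\mathcal Z\subseteq\mathbb R^m$, a loss $\ell$, a transportation cost $c$, samples $\hat z_1,\dots,\hat z_N\in\mathcal Z$ and a radius $\rho>0$. A transportation cost $c:\mathcal Z\times\mathcal Z\to\mathbb R_+$ is lower semicontinuous, satisfies $c(z,z)=0$ for all $z$, and $c(\cdot,\hat z)$ is convex for every fixed $\hat z\in\mathcal Z$. The optimal transport discrepancy is $\mathrm{OT}_c(\mathbb P,\mathbb Q)=\min_{\gamma}\mathbb E_{(z,\hat z)\sim\gamma}[c(z,\hat z)]$ over couplings $\gamma$ of $\mathbb P$ and $\mathbb Q$. Let $\hat{\mathbb P}=\frac1N\sum_{i=1}^N\delta_{\hat z_i}$ and $\mathcal P=\{\mathbb P\in\mathcal P(\mathcal Z):\mathrm{OT}_c(\mathbb P,\hat{\mathbb P})\le\rho\}$. Regularity assumption. (i) $\mathcal X$ is nonempty and convex; there exist $\mathbb Q_0\in\mathcal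 P$ and $x_0\in\mathcal X$ such that $x\mapsto\mathbb E_{z\sim\mathbb Q_0}[\ell(x,z)]$ is inf-compact on $\mathcal X$ (all sublevel sets are compact) and $\mathbb E_{z\sim\mathbb Q_0}[\ell(x_0,z)]>-\infty$; $\mathcal Z$ is nonempty, closed and convex. (ii) $\ell(x,z)=\max_{k\in[K]}\ell_k(x,z)$ with $K\ge2$, where each $\ell_k:\mathbb R^n\times\mathbb R^m\to\mathbb R$ is real-valued, convex in its first and concave in its second argument. (iii) There exist a norm $\|\cdot\|$ on $\mathbb R^m$ and $p\ge1$ with $c(z,\hat z)\ge\|z-\hat z\|^p$ for all $z,\hat z\in\mathcal Z$; moreover, if $p=1$, then for every $x\in\mathcal X$ there exist $g>0$, $\hat z_0\in\mathcal Z$ and $r\in[0,1)$ such that $\ell(x,z)\le g[1+\|z-\hat z_0\|^r]$ for all $z\in\mathcal Z$. *)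

(* Defs.v *)
From HB Require Import structures.
From mathcomp Require Import all_boot all_order all_algebra.
From mathcomp Require Import all_classical all_reals all_analysis.

Set Implicit Arguments.
Unset Strict Implicit.
Unset Printing Implicit Defensive.
Import Order.TTheory GRing.Theory Num.Theory.
Import numFieldNormedType.Exports.

Local Open Scope classical_set_scope.
Local Open Scope ring_scope.

(* R^m with its Borel sigma-algebra *)
Notation borelRV R m := (g_sigma_algebraType (@open 'rV[R]_m)).

Section norm.
Variables (R : realType) (m : nat).

Definition is_norm (nrm : 'rV[R]_m -> R) : Prop :=
  [/\ forall u v, nrm (u + v) <= nrm u + nrm v,
      forall a v, nrm (a *: v) = `|a| * nrm v
    & forall v, nrm v = 0 -> v = 0].

End norm.

Section transport.
Variables (R : realType) (m : nat).
Local Notation V := 'rV[R]_m.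
Local Notation B := (borelRV R m).

(* The cost is a function on Z x Z; its values elsewhere are irrelevant.
   Lower semicontinuity is taken in the topology of Z x Z. *)
Definition transport_cost (Z : set V) (c : V -> V -> R) : Prop :=
  [/\ forall z zh, Z z -> Z zh -> 0 <= c z zh,
      lower_semicontinuous
        (fun q : subspace (Z `*` Z) => (c q.1 q.2)%:E : \bar R),
      forall z, Z z -> c z z = 0
    & forall zh, Z zh -> convex_function Z (fun z => c z zh)].

Definition coupling (P Q : set B -> \bar R) (g : probability (B * B)%type R)
    : Prop :=
  forall A : set B, measurable A ->
    pushforward g fst A = P A /\ pushforward g snd A = Q A.

Definition OT (Z : set V) (c : V -> V -> R) (P Q : set B -> \bar R) : \bar R :=
  ereal_inf [set (\int[g]_(q in Z `*` Z) (c q.1 q.2)%:E)%E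
            | g in [set g | coupling P Q g]].

Definition empirical (N : nat) (zh : 'I_N -> V) (A : set B) : \bar R :=
  ((N%:R^-1)%:E * \sum_(i < N) \d_(zh i : B) A)%E.

Definition at_least_atoms (M : nat) (Q : set B -> \bar R) : Prop :=
  exists a : 'I_M -> B, injective a /\ forall i, (0 < Q [set a i])%E.

End transport.

Section dro.
Variables (R : realType) (n N : nat).

Record dro_instance := DROInstance {
  dimZ : nat;
  npieces : nat;
  decisions : set 'rV[R]_n;
  support_set : set 'rV[R]_dimZ;
  piece : 'I_npieces -> 'rV[R]_n -> 'rV[R]_dimZ -> R;
  cost : 'rV[R]_dimZ -> 'rV[R]_dimZ -> R;
  sample : 'I_N -> 'rV[R]_dimZ;
  radius : R }.

Variable I : dro_instance.
Local Notation m := (dimZ I).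
Local Notation K := (npieces I).
Local Notation X := (@decisions I).
Local Notation Z := (@support_set I).
Local Notation B := (borelRV R m).

(* Real-valued as soon as K > 0. *)
Definition loss (x : 'rV[R]_n) (z : 'rV[R]_m) : \bar R :=
  \big[maxe/-oo%E]_(k < K) (@piece I k x z)%:E.

Definition expected_loss (Q : probability B R) (x : 'rV[R]_n) : \bar R :=
  (\int[Q]_(z in Z) loss x z)%E.

(* Probability measures on Z are those on R^m giving mass 1 to Z. *)
Definition ambiguity_set : set (probability B R) :=
  [set Q | Q Z = 1%E /\
    (OT Z (@cost I) Q (empirical (@sample I)) <= (radius I)%:E)%E].

Definition inf_compact (f : 'rV[R]_n -> \bar R) : Prop :=
  forall a : R, compact [set x | X x /\ (f x <= a%:E)%E].

Definition well_formed : Prop :=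
  [/\ forall i, Z (@sample I i), 0 < radius I & transport_cost Z (@cost I)].

Definition regular_sets : Prop :=
  [/\ X !=set0, convex_set X,
      exists Q0 x0, [/\ ambiguity_set Q0, X x0,
        inf_compact (expected_loss Q0) & (-oo < expected_loss Q0 x0)%E]
    & [/\ Z !=set0, closed Z & convex_set Z]].

Definition regular_loss : Prop :=
  [/\ (2 <= K)%N,
      forall k z, convex_function setT (fun x => @piece I k x z)
    & forall k x, convex_function setT (fun z => - @piece I k x z)].

Definition regular_growth : Prop :=
  exists nrm : 'rV[R]_m -> R, exists p : R,
  [/\ is_norm nrm, 1 <= p,
      forall z zh, Z z -> Z zh -> nrm (z - zh) `^ p <= @cost I z zh
    & p = 1 -> forall x, X x -> exists g z0 r,
        [/\ 0 < g, Z z0, 0 <= r < 1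
          & forall z, Z z ->
              (loss x z <= (g * (1 + nrm (z - z0) `^ r))%:E)%E]].

Definition regular : Prop :=
  [/\ well_formed, regular_sets, regular_loss & regular_growth].

Definition dual_objective (Q : probability B R) : \bar R :=
  ereal_inf [set expected_loss Q x | x in X].

Definition dual_maximizer (Q : probability B R) : Prop :=
  ambiguity_set Q /\
  forall Q', ambiguity_set Q' -> (dual_objective Q' <= dual_objective Q)%E.

End dro.

(* Main.v *)
(** A point is z = (w, y) with a height w in R and a place y in R^N; the samples
    are (0, e_i), the cost is the squared Euclidean distance, and the loss is
      l(x, z) = max (0, w - 1 + sum_i y_i kappa_i(x))
    with kappa ([tilt] below) linear in x.  Since max (0, w - 1) <= w^2 / 4, with equality only
    at w = 0 and w = 2, the multiplier 1/4 certifies rho / 4 as an upper bound on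
    the dual value, and a distribution attaining it lives on the 2N points
    (0, e_i), (2, e_i), each pair carrying the mass 1/N of its sample.  If b_i is
    the mass of (2, e_i), then attaining the bound also forces
    sum_i b_i = rho / 4 and sum_i b_i kappa_i(x) = 0 for all decisions x.  The
    linear map kappa is chosen so that the latter reads
    b_1 = ... = b_d = sum_(i = 0 or i > d) b_i with d = min (n, N - 1): thus at
    least d + 1 of the b_i are positive, and rho is so small that none of them
    exhausts the mass 1/N.  Infima over couplings need not be attained, so the
    complementary slackness is derived from weak duality alone, by testing it
    with enlarged left-hand sides. *)

Require Import Defs.
From HB Require Import structures.
From mathcomp Require Import all_boot all_order all_algebra.
From mathcomp Require Import all_classical all_reals all_analysis.
From mathcomp Require Import measurable_realfun lra ring zify.
Import Order.TTheory GRing.Theory Num.Theory.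
Import numFieldNormedType.Exports.
Local Open Scope classical_set_scope.
Local Open Scope ring_scope.

Set Implicit Arguments.
Unset Strict Implicit.
Unset Printing Implicit Defensive.

(** * General facts: finite sums, Borel measurability, finitely supported measures *)

Lemma fsbig_fintype (R : Type) (idx : R) (op : Monoid.com_law idx)
    (I : finType) (F : I -> R) :
  \big[op/idx]_(i \in [set: I]) F i = \big[op/idx]_i F i.
Proof.
rewrite (_ : [set: I] = [set` enum I]); last first.
  by apply/seteqP; split => // i _ /=; rewrite mem_enum.
by rewrite -fsbig_seq ?enum_uniq// big_enum.
Qed.

Lemma continuous_measurable_borelRV (R : realType) (m : nat)
    (f : 'rV[R]_m -> R) :
  continuous f -> measurable_fun setT (f : borelRV R m -> R).
Proof.
move=> /continuousP cf; apply: (measurability _ (RGenOpens.measurableE R)).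
move=> _ [_ [a [b ->] <-]]; rewrite setTI.
by apply: sub_sigma_algebra; apply: cf; exact: interval_open.
Qed.

Lemma coord_measurable (R : realType) (m : nat) (j : 'I_m) :
  measurable_fun setT (fun z : borelRV R m => (z : 'rV[R]_m) 0 j).
Proof.
by apply: continuous_measurable_borelRV; exact: coord_continuous.
Qed.

Lemma borelRV_measurable1 (R : realType) (m : nat) (z : borelRV R m) :
  measurable [set z].
Proof.
rewrite -[X in measurable X]setCK; apply: measurableC.
apply: sub_sigma_algebra; apply: closed_openC.
apply: accessible_closed_set1; apply: hausdorff_accessible.
exact: norm_hausdorff.
Qed.

(** A weighted sum of Dirac masses. The target space is general because this yields both the
    candidate distribution and its coupling with the samples, which lives on pairs of points. *)
Lemma finite_probability_exists (d : measure_display) (T : measurableType d)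
    (R : realType) (I : finType) (w : I -> R) (a : I -> T) :
    (forall i, 0 <= w i) -> \sum_i w i = 1 ->
  exists P : probability T R,
    (forall A, P A = \sum_i ((w i)%:E * \d_(a i) A)%E) /\
    (forall f : T -> R, measurable_fun setT f -> (forall t, 0 <= f t) ->
       (\int[P]_t (f t)%:E)%E = (\sum_i (w i * f (a i)))%:E).
Proof.
move=> w0 w1.
(* [msum] takes measures indexed by [nat]: the elements of [I] are enumerated, and all later terms
   are zero. *)
pose m_ (k : nat) : {measure set T -> \bar R} :=
  if insub k is Some j then
    mscale (NngNum (w0 (enum_val (j : 'I_#|I|)))) (dirac (a (enum_val j)))
  else mzero.
pose P := msum m_ #|I|.
have mE (k : 'I_#|I|) :
    m_ k = mscale (NngNum (w0 (enum_val k))) (dirac (a (enum_val k))).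
  rewrite /m_; case: insubP => [j _ jk|]; last by rewrite ltn_ord.
  by rewrite (_ : k = j)//; exact: val_inj.
have sumI (F : I -> \bar R) :
    (\sum_i F i = \sum_(k < #|I|) F (enum_val k))%E.
  by rewrite -(big_enum_val (A := I)).
have PE A : P A = (\sum_i ((w i)%:E * \d_(a i) A))%E.
  rewrite /P /msum sumI.
  by apply: eq_bigr => k _; rewrite mE.
have PT : P setT = 1%E.
  rewrite PE -[RHS](congr1 EFin w1) -sumEFin; apply: eq_bigr => i _.
  by rewrite diracT mule1.
pose mP := Measure_isProbability.Build _ _ _ P PT.
pose PP : probability T R := HB.pack P mP.
exists PP; split; first exact: PE.
move=> f mf f0; have /measurable_EFinP mf' := mf.
rewrite (_ : integral _ _ _ = \int[P]_t (f t)%:E)%E//.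
rewrite ge0_integral_measure_sum//; last by move=> x _; rewrite lee_fin.
rewrite -sumEFin sumI.
apply: eq_bigr => k _; rewrite mE ge0_integral_mscale//; last first.
  by move=> x _; rewrite lee_fin.
by rewrite integral_dirac// diracT mul1e.
Qed.

(** * Weak duality for transport to an empirical measure *)

Section weak_duality.
Variables (R : realType) (m N : nat) (c : 'rV[R]_m -> 'rV[R]_m -> R).
Variables (zh : 'I_N -> 'rV[R]_m).
Local Notation B := (borelRV R m).
Hypothesis c_meas : measurable_fun setT (fun q : (B * B)%type => c q.1 q.2).
Hypothesis c_ge0 : forall z z', 0 <= c z z'.
Hypothesis zh_inj : injective zh.

Lemma empirical1 (i : 'I_N) :
  empirical zh [set zh i : B] = (N%:R^-1)%:E.
Proof.
rewrite /empirical (bigD1 i)//= diracE mem_set// big1 ?adde0 ?mule1// => j ji.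
by rewrite diracE memNset//= => /zh_inj /eqP; rewrite (negbTE ji).
Qed.

(** Under a coupling the second coordinate is almost surely a sample, so the pointwise bound on [f]
    can be integrated; each price [h i] is then weighted by the mass 1/N of its sample. *)
Lemma OT_weak_duality (Q : probability B R) (rho lam : R) (f : B -> R)
    (h : 'I_N -> R) :
    (0 < N)%N -> (OT setT c Q (empirical zh) <= rho%:E)%E -> 0 <= lam ->
    measurable_fun setT f -> (forall z, 0 <= f z) -> (forall i, 0 <= h i) ->
    (forall z i, f z <= lam * c z (zh i) + h i) ->
  (\int[Q]_z (f z)%:E <= (lam * rho + N%:R^-1 * \sum_i h i)%:E)%E.
Proof.
move=> N0 OTle lam0 mf f0 h0 fle.
apply/lee_addgt0Pr => e e0.
(* A coupling within e / (lam + 1) of the bound is taken: multiplied by lam, this excess is at most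
   e, and lam = 0 is allowed. *)
have l1 : 0 < lam + 1 by rewrite ltr_wpDl.
have : (OT setT c Q (empirical zh) < (rho + e / (lam + 1))%:E)%E.
  by apply: (le_lt_trans OTle); rewrite lte_fin ltrDl divr_gt0.
case/ereal_inf_lt => _ [g /= gc <-]; rewrite setXTT => clt.
have mfe : measurable_fun setT (fun z : B => (f z)%:E).
  exact/measurable_EFinP.
have -> : (\int[Q]_z (f z)%:E = \int[g]_q (f q.1)%:E)%E.
  rewrite (@eq_measure_integral _ _ _ _ (pushforward g fst)); last first.
    by move=> A mA _; have [] := gc A mA.
  by rewrite ge0_integral_pushforward// => y _; rewrite lee_fin.
have msnd i : measurable (snd @^-1` [set zh i : B] : set (B * B)).
  by rewrite -[X in measurable X]setTI; apply: measurable_snd => //;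
    exact: borelRV_measurable1.
(* [H q] is [h i] whenever the second coordinate of [q] is sample i. *)
pose H (q : B * B) := (\sum_i (h i)%:E * (\1_(snd @^-1` [set zh i : B]) q)%:E)%E.
have mind i : measurable_fun setT
    (fun q : (B * B)%type => ((\1_(snd @^-1` [set zh i : B]) q : R)%:E)).
  by apply/measurable_EFinP; exact: measurable_indic.
have indge0 i (q : (B * B)%type) :
    (0 <= ((\1_(snd @^-1` [set zh i : B]) q : R)%:E))%E.
  by rewrite lee_fin.
have mH : measurable_fun setT H.
  apply: emeasurable_sum => i; apply: emeasurable_funM => //.
have H0 q : (0 <= H q)%E.
  by apply: sume_ge0 => i _; rewrite mule_ge0// lee_fin.
have mce : measurable_fun setT (fun q : (B * B)%type => (c q.1 q.2)%:E).
  exact/measurable_EFinP.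
have gsnd i : g (snd @^-1` [set zh i : B]) = (N%:R^-1)%:E.
  have [_] := gc _ (borelRV_measurable1 (zh i)).
  by rewrite empirical1 => <-.
have intH : (\int[g]_q H q = (N%:R^-1 * \sum_i h i)%:E)%E.
  rewrite /H ge0_integral_sum//; last 2 first.
  - by move=> i; apply: emeasurable_funM.
  - by move=> i q _; rewrite mule_ge0// lee_fin.
  rewrite mulr_sumr -sumEFin; apply: eq_bigr => i _.
  rewrite ge0_integralZl_EFin// integral_indic// setIT.
  by rewrite [X in (_ * X)%E](gsnd i) -EFinM mulrC.
have mZ : measurable_fun setT
    (fun q : (B * B)%type => (lam%:E * (c q.1 q.2)%:E)%E).
  exact: emeasurable_funM.
(* The samples are distinct, so the preimages of their singletons are disjoint and their N masses
   1/N add up to 1. *)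
have ae_snd : {ae g, forall q : B * B, exists i, q.2 = zh i}.
  exists (~` \bigcup_(i in [set: 'I_N]) (snd @^-1` [set zh i : B])); split.
  - apply: measurableC; apply: fin_bigcup_measurable => //.
  - rewrite probability_setC; last by apply: fin_bigcup_measurable.
    rewrite measure_fin_bigcup//; last 2 first.
      exact: finite_finset.
      by apply/trivIsetP => i j _ _ ij; apply/seteqP; split => // q /= [-> /zh_inj/eqP];
        rewrite (negbTE ij).
    rewrite fsbig_fintype (eq_bigr (fun=> (N%:R^-1)%:E)); last by move=> i _; exact: gsnd.
    rewrite sumEFin sumr_const card_ord -(mulr_natr N%:R^-1 N) mulVf; last first.
      by rewrite pnatr_eq0 -lt0n.
    by rewrite subee.
  - move=> q /=; apply: contra_not => -[i _ /= ->]; by exists i.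
apply: (@le_trans _ _ (\int[g]_q (lam%:E * (c q.1 q.2)%:E + H q))%E).
  apply: ae_ge0_le_integral => //=.
  - by move=> q _; rewrite lee_fin.
  - by apply: (measurableT_comp mfe); exact: measurable_fst.
  - by move=> q _; rewrite adde_ge0// mule_ge0// lee_fin.
  - exact: emeasurable_funD.
  - case: ae_snd => S [mS gS0 hS]; exists S; split => // q /= nq; apply: hS => /= -[i qi].
    apply: nq => _; rewrite /H (bigD1 i)//= big1 ?adde0; last first.
      move=> j ji; rewrite indicE memNset ?mule0//= qi => /zh_inj ij.
      by rewrite ij eqxx in ji.
    rewrite indicE mem_set//= mule1 -EFinM -EFinD lee_fin.
    by rewrite qi; exact: fle.
rewrite ge0_integralD//; last by move=> q _; rewrite mule_ge0// lee_fin.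
rewrite intH ge0_integralZl_EFin//; last by move=> q _; rewrite lee_fin.
have := ltW clt; move=> /(lee_wpmul2l (x := lam%:E)).
rewrite lee_fin => /(_ lam0) cle.
apply: (le_trans (leeD cle (lexx _))).
rewrite -EFinM -!EFinD lee_fin.
have : lam * (e / (lam + 1)) <= e.
  by rewrite mulrA ler_pdivrMr// mulrC ler_pM2l// lerDl.
lra.
Qed.

End weak_duality.

(** * The instance: atoms, distance, loss and box of decisions *)

Section split_instance.
Variables (R : realType) (n N : nat).
Local Notation V := 'rV[R]_N.+1.
Local Notation B := (borelRV R N.+1).

Definition height (z : V) : R := z 0 0.
Definition place (z : V) (i : 'I_N) : R := z 0 (lift ord0 i).

(** Coordinate [ord0] is the height, the others form the place: [atom false i] is sample i, and
    [atom true i] lies 2 above it. *)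
Definition atom (b : bool) (i : 'I_N) : V :=
  \row_j oapp (fun k => (k == i)%:R) (if b then 2 else 0) (unlift ord0 j).

Lemma height_atom b i : height (atom b i) = if b then 2 else 0.
Proof. by rewrite /height mxE unlift_none. Qed.

Lemma place_atom b i k : place (atom b i) k = (k == i)%:R.
Proof. by rewrite /place mxE liftK. Qed.

Lemma eq_atom (b : bool) (i : 'I_N) (z : V) :
    height z = (if b then 2 else 0) -> (forall k, place z k = (k == i)%:R) ->
  z = atom b i.
Proof.
move=> hz pz; apply/rowP => j; case: (unliftP ord0 j) => [k|] ->.
  by have := pz k; rewrite /place => ->; rewrite mxE liftK.
by have := hz; rewrite /height => ->; rewrite mxE unlift_none.
Qed.

Lemma atom_inj b b' i i' : atom b i = atom b' i' -> b = b' /\ i = i'.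
Proof.
move=> E; split.
  have := congr1 height E; rewrite !height_atom.
  by case: b b' {E} => -[] // H; exfalso; lra.
have := congr1 (place^~ i) E; rewrite !place_atom eqxx.
by case: eqP => // _ /eqP; rewrite oner_eq0.
Qed.

Definition place_dist (z z' : V) : R := \sum_i (place z i - place z' i) ^+ 2.

Definition sqdist (z z' : V) : R := \sum_j (z 0 j - z' 0 j) ^+ 2.

Lemma sqdistE z z' :
  sqdist z z' = (height z - height z') ^+ 2 + place_dist z z'.
Proof. by rewrite /sqdist big_ord_recl. Qed.

Lemma place_dist_ge0 z z' : 0 <= place_dist z z'.
Proof. by apply: sumr_ge0 => i _; exact: sqr_ge0. Qed.

Lemma sqdist_ge0 z z' : 0 <= sqdist z z'.
Proof. by apply: sumr_ge0 => i _; exact: sqr_ge0. Qed.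

Lemma place_dist_eq0 z b i :
  place_dist z (atom b i) = 0 -> forall k, place z k = (k == i)%:R.
Proof.
move=> /eqP; rewrite psumr_eq0 => [/allP H k|j _]; last exact: sqr_ge0.
have := H k (mem_index_enum _).
by rewrite sqrf_eq0 subr_eq0 place_atom => /eqP.
Qed.

Lemma place_dist_atom b b' i i' :
  place_dist (atom b i) (atom b' i') = if i == i' then 0 else 2.
Proof.
rewrite /place_dist; have [->|ii'] := eqVneq i i'.
  by rewrite big1// => k _; rewrite !place_atom subrr expr0n.
rewrite (bigD1 i)//= (bigD1 i')//=; last by rewrite eq_sym.
rewrite !place_atom !eqxx (negbTE ii') eq_sym (negbTE ii') big1 ?addr0; last first.
  move=> k /andP[ki ki']; rewrite !place_atom (negbTE ki) (negbTE ki').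
  by rewrite subrr expr0n.
by rewrite subr0 sub0r sqrrN !expr1n.
Qed.

(* Testing the masses b_i against column j < N - 1 of this matrix gives b_(j+1)
   minus the sum of the b_i with i = 0 or i > n; later columns vanish, so that
   superfluous decision coordinates have no effect. *)
Definition tilt_coef (i : 'I_N) (j : 'I_n) : R :=
  (i == j.+1 :> nat)%:R - (~~ (0 < i <= n) && (j.+1 < N))%N%:R.

Definition tilt (x : 'rV[R]_n) (i : 'I_N) : R :=
  \sum_j x 0 j * tilt_coef i j.

Definition affine_piece (x : 'rV[R]_n) (z : V) : R :=
  height z - 1 + \sum_i place z i * tilt x i.

(* On this box every kappa_i(x) lies in [-1, 1], so that the active piece at each
   of the 2N atoms does not depend on x. *)
Definition box : set 'rV[R]_n :=
  [set x | forall j, `[- n%:R^-1, n%:R^-1]%classic (x ord0 j)].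

(** Chosen so that N such masses total 1 / (2N), less than the mass 1/N of a single sample. *)
Definition base_mass : R := (2 * N%:R ^+ 2)^-1.

(** Indices up to n carry equal masses, so that each of 1, ..., n balances index 0, the only other
    index with mass. *)
Definition lifted_mass (i : 'I_N) : R := base_mass *+ (i <= n)%N.

Definition budget : R := \sum_i lifted_mass i.

(** Lifting a unit of mass from height 0 to height 2 costs 4, whence the radius. *)
Definition split_instance : dro_instance R n N :=
  @DROInstance R n N N.+1 2 box setT
    (fun k x z => if k == ord0 then 0 else affine_piece x z)
    sqdist (atom false) (4 * budget).

Definition rloss (x : 'rV[R]_n) (z : V) : R := Num.max 0 (affine_piece x z).

Lemma lossE x z : loss (I := split_instance) x z = (rloss x z)%:E.
Proof.
rewrite /loss/= 2!big_ord_recl big_ord0/= maxeNy.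
by rewrite /rloss EFin_max.
Qed.

Lemma measurable_height : measurable_fun setT (height : B -> R).
Proof. exact: coord_measurable. Qed.

Lemma measurable_place i : measurable_fun setT (place^~ i : B -> R).
Proof. exact: coord_measurable. Qed.

Lemma measurable_rloss x : measurable_fun setT (rloss x : B -> R).
Proof.
apply: measurable_maxr => //; apply: measurable_funD.
  apply: measurable_funD => //; exact: measurable_height.
apply: measurable_sum => i; apply: measurable_funM => //.
exact: measurable_place.
Qed.

Lemma measurable_sqdist :
  measurable_fun setT (fun q : (B * B)%type => sqdist q.1 q.2).
Proof.
apply: measurable_sum => j; apply: measurable_funX; apply: measurable_funB.
  by apply: (measurableT_comp (@coord_measurable R N.+1 j)); exact: measurable_fst.
by apply: (measurableT_comp (@coord_measurable R N.+1 j)); exact: measurable_snd.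
Qed.

Lemma measurable_sqdistl z' : measurable_fun setT (sqdist^~ z' : B -> R).
Proof.
apply: measurable_sum => j; apply: measurable_funX; apply: measurable_funB => //.
exact: coord_measurable.
Qed.

Lemma measurable_place_dist z' : measurable_fun setT (place_dist^~ z' : B -> R).
Proof.
apply: measurable_sum => j; apply: measurable_funX; apply: measurable_funB => //.
exact: measurable_place.
Qed.

Lemma tilt0 i : tilt 0 i = 0.
Proof. by rewrite /tilt big1// => j _; rewrite mxE mul0r. Qed.

Lemma box0 : box 0.
Proof.
by move=> j; rewrite /= in_itv/= mxE oppr_le0 invr_ge0 ler0n.
Qed.

Lemma boxN x : box x -> box (- x).
Proof.
move=> bx j; have := bx j; rewrite /= !in_itv/= mxE => /andP[h1 h2].
by rewrite lerNr opprK h2 lerNl h1.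
Qed.

Lemma tiltN x i : tilt (- x) i = - tilt x i.
Proof. by rewrite /tilt -sumrN; apply: eq_bigr => j _; rewrite mxE mulNr. Qed.

Lemma tilt_coef_le1 i j : `|tilt_coef i j| <= 1.
Proof.
rewrite /tilt_coef; case: (_ == _ :> nat); case: (_ && _);
  by rewrite ?subrr ?subr0 ?sub0r ?normrN ?normr1 ?normr0.
Qed.

(** Each of the n terms is at most 1/n in absolute value. *)
Lemma tilt_le1 x i : box x -> `|tilt x i| <= 1.
Proof.
move=> bx; apply: (le_trans (ler_norm_sum _ _ _)).
apply: (@le_trans _ _ (\sum_(j < n) n%:R^-1)).
  apply: ler_sum => j _; rewrite normrM -[leRHS]mulr1.
  apply: ler_pM => //; last exact: tilt_coef_le1.
  by have := bx j; rewrite /= in_itv/= -ler_norml.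
rewrite sumr_const card_ord -(mulr_natr n%:R^-1 n).
by have [->|n0] := eqVneq n 0%N; rewrite ?mulr0// mulVf// pnatr_eq0.
Qed.

Lemma rloss_ge0 x z : 0 <= rloss x z.
Proof. by rewrite /rloss le_max lexx. Qed.

Lemma affine_piece_atom x b i :
  affine_piece x (atom b i) = (if b then 1 else -1) + tilt x i.
Proof.
rewrite /affine_piece height_atom (bigD1 i)//= place_atom eqxx mul1r big1 ?addr0.
  by case: b; lra.
by move=> k ki; rewrite place_atom (negbTE ki) mul0r.
Qed.

Lemma rloss_atom x b i : box x ->
  rloss x (atom b i) = if b then 1 + tilt x i else 0.
Proof.
move=> /(tilt_le1 i); rewrite ler_norml /rloss affine_piece_atom => /andP[h1 h2].
by case: b; [apply: max_r | apply: max_l]; lra.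
Qed.

Lemma rloss0 z : rloss 0 z = Num.max 0 (height z - 1).
Proof.
rewrite /rloss /affine_piece big1 ?addr0// => i _; by rewrite tilt0 mulr0.
Qed.

Lemma rloss0_height z : rloss 0 z <= 4^-1 * height z ^+ 2.
Proof.
rewrite rloss0 ge_max; apply/andP; split; first by rewrite mulr_ge0 ?sqr_ge0.
(* With w the height, w^2 / 4 - (w - 1) = (w - 2)^2 / 4. *)
have := sqr_ge0 (height z - 2); lra.
Qed.

Lemma rloss0_height_eq z : rloss 0 z = 4^-1 * height z ^+ 2 ->
  exists b : bool, height z = if b then 2 else 0.
Proof.
rewrite rloss0 maxEle; case: ifP => _ E.
  exists true; have : (height z - 2) ^+ 2 = 0 by lra.
  by move/eqP; rewrite sqrf_eq0 subr_eq0 => /eqP.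
exists false; have : height z ^+ 2 = 0 by lra.
by move/eqP; rewrite sqrf_eq0 => /eqP.
Qed.

Lemma sqdist_atom0 z i :
  sqdist z (atom false i) = height z ^+ 2 + place_dist z (atom false i).
Proof. by rewrite sqdistE height_atom subr0. Qed.

End split_instance.

(** * A candidate of value [budget] and the matching upper bound *)

Section optimum.
Variables (R : realType) (n N : nat).
Hypothesis N_gt0 : (0 < N)%N.
Local Notation V := 'rV[R]_N.+1.
Local Notation B := (borelRV R N.+1).
Local Notation atom := (@atom R N).
Local Notation box := (@box R n).
Local Notation budget := (@budget R n N).
Local Notation I := (@split_instance R n N).
Local Notation lifted_mass := (@lifted_mass R n N).
Local Notation tilt := (@tilt R n N).
Local Notation tilt_coef := (@tilt_coef R n N).
Local Notation rloss := (@rloss R n N).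

Lemma sum_tilt_coef (be : 'I_N -> R) (j : 'I_n) (jN : (j.+1 < N)%N) :
  \sum_i be i * tilt_coef i j =
  be (Ordinal jN) - \sum_(i < N | ~~ (0 < i <= n)%N) be i.
Proof.
under eq_bigr do rewrite /tilt_coef mulrBr jN andbT.
rewrite sumrB; congr (_ - _).
  rewrite (bigD1 (Ordinal jN))//= eqxx mulr1 big1 ?addr0// => i.
  by rewrite -val_eqE/= => /negbTE ->; rewrite mulr0.
rewrite [RHS]big_mkcond/=; apply: eq_bigr => i _.
by case: ifP; rewrite ?mulr1 ?mulr0.
Qed.

(** If j + 1 >= N the column is zero. Otherwise [base_mass] at index j + 1 cancels against
    [base_mass] at index 0, indices beyond n having no mass. *)
Lemma lifted_mass_balanced (j : 'I_n) :
  \sum_i lifted_mass i * tilt_coef i j = 0.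
Proof.
have [jN|jN] := ltnP j.+1 N; last first.
  apply: big1 => i _; rewrite /tilt_coef (ltnNge j.+1 N) jN andbF subr0.
  by rewrite ltn_eqF ?mulr0// (leq_trans (ltn_ord i)).
rewrite sum_tilt_coef (bigD1 (Ordinal N_gt0))//= big1 ?addr0.
  by rewrite /lifted_mass/= ltn_ord subrr.
move=> i /andP[ni i0]; rewrite /lifted_mass.
suff -> : (i <= n)%N = false by rewrite mulr0n.
by move: ni i0; rewrite -val_eqE/=; lia.
Qed.

Lemma lifted_mass_tilt x : \sum_i lifted_mass i * tilt x i = 0.
Proof.
rewrite /tilt; under eq_bigr do rewrite mulr_sumr.
rewrite exchange_big/= big1// => j _.
under eq_bigr do rewrite mulrCA.
by rewrite -mulr_sumr lifted_mass_balanced mulr0.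
Qed.

Lemma base_mass_gt0 : 0 < base_mass R N.
Proof. by rewrite invr_gt0 mulr_gt0// exprn_gt0// ltr0n. Qed.

Lemma lifted_mass_ge0 i : 0 <= lifted_mass i.
Proof. by rewrite mulrn_wge0// ltW// base_mass_gt0. Qed.

Lemma budget_lt : budget < N%:R^-1.
Proof.
have N0 : 0 < N%:R :> R by rewrite ltr0n.
apply: (@le_lt_trans _ _ (\sum_(i < N) base_mass R N)).
  apply: ler_sum => i _; rewrite /lifted_mass; case: leqP => _ //.
  by rewrite mulr0n ltW// base_mass_gt0.
rewrite sumr_const card_ord -(mulr_natr (base_mass R N) N) /base_mass.
have -> : (2 * N%:R ^+ 2)^-1 * N%:R = 2^-1 * N%:R^-1 :> R.
  by field; rewrite gt_eqF.
by rewrite gtr_pMl ?invr_gt0// invf_lt1// ltr1n.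
Qed.

Lemma lifted_mass_le_budget i : lifted_mass i <= budget.
Proof.
rewrite /budget (bigD1 i)//= lerDl; apply: sumr_ge0 => k _.
exact: lifted_mass_ge0.
Qed.

Lemma budget_gt0 : 0 < budget.
Proof.
apply: lt_le_trans (lifted_mass_le_budget (Ordinal N_gt0)).
by rewrite /lifted_mass leq0n base_mass_gt0.
Qed.

Lemma atom_false_inj : injective (atom false).
Proof. by move=> i j /atom_inj[]. Qed.

(** Sample i sends the part [lifted_mass i] of its mass straight up to height 2. This costs 4 per
    unit, and the balance of the lifted masses makes the expected loss constant in x. *)
Lemma feasible_candidate : exists Q : probability B R,
  ambiguity_set (I := I) Q /\
  forall x, box x -> expected_loss (I := I) Q x = budget%:E.
Proof.
pose w (p : bool * 'I_N) : R :=
  if p.1 then lifted_mass p.2 else N%:R^-1 - lifted_mass p.2.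
have w0 p : 0 <= w p.
  case: p => -[] i; rewrite /w/= ?lifted_mass_ge0// subr_ge0.
  exact: (le_trans (lifted_mass_le_budget i) (ltW budget_lt)).
have sumP (F : bool * 'I_N -> R) :
    \sum_p F p = \sum_i (F (true, i) + F (false, i)).
  rewrite big_split/= -(big_bool _ (fun b => \sum_i F (b, i))) pair_bigA/=.
  by apply: eq_bigr => -[].
have w1 : \sum_p w p = 1.
  rewrite sumP /w/=; under eq_bigr do rewrite subrKC.
  by rewrite sumr_const card_ord -(mulr_natr N%:R^-1 N) mulVf// pnatr_eq0 -lt0n.
have [Q [QE Qint]] := finite_probability_exists
  (fun p : bool * 'I_N => atom p.1 p.2 : B) w0 w1.
(* The coupling sends both atoms at place i to sample i, so that only the height is paid for. *)
have [g [gE gint]] := finite_probability_exists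
  (fun p : bool * 'I_N => (atom p.1 p.2 : B, atom false p.2 : B)) w0 w1.
exists Q; split.
  split; first exact: probability_setT.
  apply: (@le_trans _ _ (\int[g]_(q in setT `*` setT) (sqdist q.1 q.2)%:E)%E).
    apply: ereal_inf_lbound; exists g => //= A mA; split.
      rewrite /pushforward gE QE; apply: eq_bigr => p _.
      by rewrite !diracE.
    rewrite /pushforward gE /empirical.
    rewrite ge0_sume_distrr//.
    rewrite (eq_bigr (fun p : bool * 'I_N =>
      (w p)%:E * \d_(atom false p.2 : B) A)%E); last by move=> p _; rewrite !diracE.
    rewrite (eq_bigr (fun p : bool * 'I_N =>
      (w (p.1, p.2))%:E * \d_(atom false p.2 : B) A)%E); last by case.
    rewrite -(pair_bigA _ (fun b i => (w (b, i))%:E * \d_(atom false i : B) A)%E)/=.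
    rewrite exchange_big/=; apply: eq_bigr => i _.
    rewrite big_bool/= -ge0_muleDl ?lee_fin// /w/=.
    by rewrite -EFinD subrKC.
  rewrite setXTT gint; [|exact: measurable_sqdist|by move=> q; exact: sqdist_ge0].
  rewrite lee_fin sumP/= /budget mulr_sumr ler_sum// => i _.
  rewrite /w/= !sqdist_atom0 !height_atom !place_dist_atom eqxx.
  lra.
move=> x bx; rewrite /expected_loss.
under eq_integral do rewrite lossE.
rewrite (Qint (rloss x)); [|exact: measurable_rloss|exact: rloss_ge0].
rewrite sumP/= /w/=; under eq_bigr do rewrite !rloss_atom// mulr0 addr0 mulrDr mulr1.
by rewrite big_split/= lifted_mass_tilt addr0.
Qed.

Definition atoms : set B :=
  \bigcup_(p in [set: bool * 'I_N]) [set (atom p.1 p.2 : B)].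

Lemma atomsP (z : V) : atoms z <-> exists b i, z = atom b i.
Proof.
split=> [[[b i] _ /= ->]|[b [i ->]]]; first by exists b, i.
by exists (b, i).
Qed.

Lemma measurable_atoms : measurable atoms.
Proof.
apply: fin_bigcup_measurable; first exact: finite_finset.
by move=> p _; exact: borelRV_measurable1.
Qed.

(** For [b = true] these are the numbers b_i of the introduction. *)
Definition mass (Q : probability B R) b i : R := fine (Q [set (atom b i : B)]).

Lemma massE (Q : probability B R) b i : Q [set (atom b i : B)] = (mass Q b i)%:E.
Proof. by rewrite fineK// fin_num_measure//; exact: borelRV_measurable1. Qed.

Lemma mass_ge0 (Q : probability B R) b i : 0 <= mass Q b i.
Proof. by rewrite -lee_fin -massE. Qed.

(** Almost surely the loss is a combination of indicators of the upper atoms, because it vanishes at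
    the lower ones. *)
Lemma expected_loss_atoms (Q : probability B R) x : Q atoms = 1%E -> box x ->
  expected_loss (I := I) Q x =
  (\sum_i mass Q true i * (1 + tilt x i))%:E.
Proof.
move=> Q1 bx; rewrite /expected_loss.
under eq_integral do rewrite lossE.
have QC : Q (~` atoms) = 0%E.
  by rewrite probability_setC ?Q1 ?subee//; exact: measurable_atoms.
have t0 i : 0 <= 1 + tilt x i.
  by have := tilt_le1 i bx; rewrite ler_norml => /andP[]; lra.
have mind i : measurable_fun setT
    (fun z : B => ((1 + tilt x i)%:E * (\1_[set (atom true i : B)] z)%:E)%E).
  apply: emeasurable_funM => //; apply/measurable_EFinP.
  by apply: measurable_indic; exact: borelRV_measurable1.
pose L (z : B) := (\sum_i ((1 + tilt x i)%:E * (\1_[set (atom true i : B)] z)%:E))%E.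
have indge0 i (z : B) : (0 <= (1 + tilt x i)%:E * (\1_[set (atom true i : B)] z)%:E)%E.
  by rewrite mule_ge0// lee_fin.
rewrite (@ge0_ae_eq_integral _ _ _ _ _ _ L)//=; first last.
- exists (~` atoms); split.
  + exact: measurableC measurable_atoms.
  + exact: QC.
  + move=> z /=; apply: contra_not => /atomsP[b [i ->]] _.
    rewrite rloss_atom// /L; case: b.
      rewrite (bigD1 i)//= indicE mem_set// mule1 big1 ?adde0// => k ki.
      rewrite indicE memNset ?mule0//= => /atom_inj[_ ik].
      by rewrite ik eqxx in ki.
    rewrite big1// => k _; rewrite indicE memNset ?mule0//= => /atom_inj[] //.
- by move=> z _; exact: sume_ge0.
- by move=> z _; rewrite lee_fin; exact: rloss_ge0.
- exact: emeasurable_sum.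
- by apply/measurable_EFinP; exact: measurable_rloss.
rewrite /L ge0_integral_sum// -sumEFin; apply: eq_bigr => i _.
rewrite ge0_integralZl_EFin//; last first.
  by apply/measurable_EFinP; apply: measurable_indic; exact: borelRV_measurable1.
rewrite integral_indic//; last exact: borelRV_measurable1.
by rewrite setIT [X in (_ * X)%E](massE Q true i) -EFinM mulrC.
Qed.

(** Weak duality at the multiplier 1/4, where the radius contributes exactly [budget]; [f] and [h]
    stay free so that perturbed losses and prices can be tested. *)
Lemma dual_bound (Q : probability B R) (f : B -> R) (h : 'I_N -> R) :
    ambiguity_set (I := I) Q ->
    measurable_fun setT f -> (forall z, 0 <= f z) -> (forall i, 0 <= h i) ->
    (forall z i, f z <= 4^-1 * sqdist z (atom false i) + h i) ->
  (\int[Q]_z (f z)%:E <= (budget + N%:R^-1 * \sum_i h i)%:E)%E.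
Proof.
move=> [_ OTQ] mf f0 h0 fle.
have -> : budget = 4^-1 * (4 * budget) by rewrite mulKf.
have i4 : 0 <= 4^-1 :> R by rewrite invr_ge0.
exact: (OT_weak_duality (@measurable_sqdist R N) (@sqdist_ge0 R N)
  atom_false_inj N_gt0 OTQ i4 mf f0 h0 fle).
Qed.

Lemma rloss0_sqdist z i : rloss 0 z <= 4^-1 * sqdist z (atom false i).
Proof.
rewrite sqdist_atom0; have := rloss0_height n z.
have := place_dist_ge0 z (atom false i); lra.
Qed.

Lemma rloss0_bound (Q : probability B R) : ambiguity_set (I := I) Q ->
  (\int[Q]_z (rloss 0 z)%:E <= budget%:E)%E.
Proof.
move=> aQ; have := @dual_bound Q (rloss 0) (fun=> 0) aQ.
rewrite big1// mulr0 addr0; apply => //.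
- exact: measurable_rloss.
- exact: rloss_ge0.
- by move=> z i; rewrite addr0; exact: rloss0_sqdist.
Qed.

End optimum.

(** * Structure of the maximizers *)

Section maximizers.
Variables (R : realType) (n N : nat).
Hypotheses (n_gt0 : (0 < n)%N) (N_gt0 : (0 < N)%N).
Local Notation V := 'rV[R]_N.+1.
Local Notation B := (borelRV R N.+1).
Local Notation atom := (@atom R N).
Local Notation box := (@box R n).
Local Notation budget := (@budget R n N).
Local Notation I := (@split_instance R n N).
Local Notation tilt := (@tilt R n N).
Local Notation tilt_coef := (@tilt_coef R n N).
Local Notation rloss := (@rloss R n N).
Local Notation atoms := (@atoms R N).
Local Notation mass := (@mass R N).

Variable Q : probability B R.
Hypothesis Qamb : ambiguity_set (I := I) Q.
Hypothesis Qopt : forall x, box x -> (budget%:E <= expected_loss (I := I) Q x)%E.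

Lemma integral_rloss0 : (\int[Q]_z (rloss 0 z)%:E = budget%:E)%E.
Proof.
apply/eqP; rewrite eq_le rloss0_bound//=.
have := Qopt (@box0 R n); rewrite /expected_loss.
by under eq_integral do rewrite lossE.
Qed.

(** Complementary slackness: the dual bound is tight for the loss at x = 0, so whatever the prices
    [h] allow to be added to that loss integrates to at most the cost of these prices. *)
Lemma integral_slack (F : B -> R) (h : 'I_N -> R) :
    measurable_fun setT F -> (forall z, 0 <= F z) -> (forall i, 0 <= h i) ->
    (forall z i, rloss 0 z + F z <= 4^-1 * sqdist z (atom false i) + h i) ->
  (\int[Q]_z (F z)%:E <= (N%:R^-1 * \sum_i h i)%:E)%E.
Proof.
move=> mF F0 h0 Fle.
have mr := @measurable_rloss R n N 0.
have := @dual_bound R n N N_gt0 Q (rloss 0 \+ F) h Qamb.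
move=> /(_ (measurable_funD mr mF)).
have r0F z : 0 <= (rloss 0 \+ F) z by rewrite addr_ge0// rloss_ge0.
move=> /(_ r0F h0 Fle)/=.
under eq_integral do rewrite EFinD.
rewrite ge0_integralD//.
- by rewrite integral_rloss0 EFinD leeD2lE.
- by move=> z _; rewrite lee_fin rloss_ge0.
- exact/measurable_EFinP.
- by move=> z _; rewrite lee_fin.
- exact/measurable_EFinP.
Qed.

(* The slack between the loss and a quarter of the squared distance to the nearest
   sample integrates to 0 and vanishes only at the atoms. *)
Lemma maximizer_concentrated : Q atoms = 1%E.
Proof.
pose i0 := Ordinal N_gt0.
(* The minimum starts from the distance to sample 0, itself in the family, so that it is always
   attained at a sample. *)
pose nearest (z : B) :=
  \big[Order.min/sqdist z (atom false i0)]_(i < N) sqdist z (atom false i).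
have mnear : measurable_fun setT nearest.
  rewrite /nearest; elim: (index_enum _) => [|i s IH].
    under eq_fun do rewrite big_nil.
    exact: measurable_sqdistl.
  under eq_fun do rewrite big_cons.
  by apply: measurable_minr => //; exact: measurable_sqdistl.
have nearE z : exists i, nearest z = sqdist z (atom false i).
  rewrite /nearest; apply: (big_ind (fun y => exists i, y = sqdist z (atom false i))).
  - by exists i0.
  - by move=> _ _ [i ->] [j ->]; rewrite minEle; case: ifP => _; [exists i|exists j].
  - by move=> i _; exists i.
pose F (z : B) := 4^-1 * nearest z - rloss 0 z.
have mF : measurable_fun setT F.
  apply: measurable_funB; last exact: measurable_rloss.
  exact: measurable_funM.
have F0 z : 0 <= F z.
  rewrite subr_ge0; have [i ->] := nearE z.
  exact: rloss0_sqdist.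
have := @integral_slack F (fun=> 0) mF F0.
rewrite big1// mulr0 => /(_ (fun=> lexx _)) FI.
have {}FI : (\int[Q]_z (F z)%:E <= 0)%E.
  apply: FI => z i; rewrite addr0 /F subrKC ler_pM2l ?invr_gt0//.
  exact: bigmin_le_cond.
have {}FI : (\int[Q]_z `|(F z)%:E| = 0)%E.
  apply/eqP; rewrite eq_le integral_ge0// andbT.
  rewrite (eq_integral (fun z => (F z)%:E))// => z _.
  by rewrite gee0_abs// lee_fin.
have /ae_eq_integral_abs : measurable_fun setT (fun z : B => (F z)%:E).
  exact/measurable_EFinP.
move=> /(_ Q measurableT)[+ _] => /(_ FI) [S [mS QS0 hS]].
apply/eqP; rewrite eq_le probability_le1/=; last exact: measurable_atoms.
have CS : ~` S `<=` atoms.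
  move=> z; apply: contra_notP => nz; apply: hS => /= /(_ Logic.I)/= [] F0z.
  apply: nz; apply/atomsP.
  have [i nE] := nearE z.
  move: F0z; rewrite /F nE sqdist_atom0 => F0z.
  (* The slack is the sum of two nonnegative terms, one from the place and one from the height, so
     both vanish. *)
  have h1 := rloss0_height n z; have h2 := place_dist_ge0 z (atom false i).
  have /place_dist_eq0 p0 : place_dist z (atom false i) = 0 by lra.
  have /rloss0_height_eq [b hb] : rloss 0 z = 4^-1 * height z ^+ 2 by lra.
  by exists b, i; exact: eq_atom.
have QS0' : Q S = 0%E by exact: QS0.
have <- : Q (~` S) = 1%E by rewrite probability_setC// QS0' sube0.
apply: le_measure => //; rewrite inE.
  exact: measurableC.
exact: measurable_atoms.
Qed.

(* The loss may be raised by 1/2 outside a neighbourhood of the i-th place if the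
   dual prices of all samples but the i-th are raised by 1/2. *)
Lemma mass_cluster i : N%:R^-1 <= mass Q false i + mass Q true i.
Proof.
(* Distinct places are at squared distance 2, so [D] contains the atoms at all other places and
   neither atom at place i. *)
pose D : set B := [set z | 2 <= place_dist z (atom false i)].
have mD : measurable D.
  rewrite -[X in measurable X]setTI.
  have := @measurable_place_dist R N (atom false i) measurableT `[2, +oo[%classic.
  have -> : D = (fun z : B => place_dist z (atom false i)) @^-1` `[2, +oo[%classic.
    by apply/seteqP; split => z /=; rewrite in_itv/= andbT.
  by apply; exact: measurable_itv.
have := @integral_slack (fun z => 2^-1 * \1_D z) (fun k => 2^-1 * (k != i)%:R).
have mI : measurable_fun setT (fun z : B => 2^-1 * \1_D z : R).
  by apply: measurable_funM => //; exact: measurable_indic.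
move=> /(_ mI).
have I0 (z : B) : 0 <= 2^-1 * \1_D z :> R by rewrite mulr_ge0.
have h0 k : 0 <= 2^-1 * (k != i)%:R :> R by rewrite mulr_ge0.
move=> /(_ I0 h0).
have QD : Q D = (fine (Q D))%:E by rewrite fineK// fin_num_measure.
have -> : (\int[Q]_z (2^-1 * \1_D z)%:E = (2^-1 * fine (Q D))%:E)%E.
  under eq_integral do rewrite EFinM.
  rewrite ge0_integralZl_EFin//; last by apply/measurable_EFinP; exact: measurable_indic.
  by rewrite integral_indic// setIT EFinM -QD.
have -> : \sum_k 2^-1 * (k != i)%:R = 2^-1 * (N%:R - 1) :> R.
  rewrite -mulr_sumr; congr (_ * _).
  rewrite (eq_bigr (fun k => 1 - (k == i)%:R)); last first.
    by move=> k _; case: eqP; rewrite ?subrr ?subr0.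
  rewrite sumrB sumr_const card_ord; congr (_ - _).
  by rewrite (bigD1 i)//= eqxx big1 ?addr0// => k /negbTE ->.
have N0 : 0 < N%:R :> R by rewrite ltr0n.
have -> : N%:R^-1 * (2^-1 * (N%:R - 1)) = 2^-1 * (1 - N%:R^-1) :> R.
  by field; rewrite gt_eqF.
rewrite lee_fin ler_pM2l ?invr_gt0// => H.
have {}H : fine (Q D) <= 1 - N%:R^-1.
  (* For k <> i the price 1/2 pays for the increase; for k = i the squared place distance is at
     least 2 on [D], and a quarter of it pays. *)
  apply: H => z k; rewrite sqdist_atom0.
  have h1 := rloss0_height n z; have h2 := place_dist_ge0 z (atom false k).
  have [->|ki] := eqVneq k i; last first.
    rewrite mulr1; have : \1_D z <= 1 :> R by rewrite indicE; case: (_ \in _).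
    lra.
  rewrite mulr0 addr0 indicE; case: (asboolP (D z)) => [Dz|nDz].
    rewrite mem_set// mulr1; have : 2 <= place_dist z (atom false i) by [].
    lra.
  rewrite memNset// mulr0; have := place_dist_ge0 z (atom false i); lra.
have QDC : Q (~` D) = (1 - fine (Q D))%:E by rewrite probability_setC// {1}QD.
have mA : measurable atoms by exact: measurable_atoms.
have QA0 : Q (~` atoms) = 0%E.
  by rewrite probability_setC ?maximizer_concentrated ?subee.
have m1 b : measurable [set (atom b i : B)] by exact: borelRV_measurable1.
(* Up to a null set the complement of [D] is contained in the two atoms at place i, whose joint mass
   is thus at least 1 - Q(D). *)
have mU : measurable (~` atoms `|` ([set (atom false i : B)] `|` [set (atom true i : B)])).
  by apply: measurableU; [exact: measurableC mA|exact: measurableU].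
have : (Q (~` D) <= Q (~` atoms `|` ([set (atom false i : B)] `|` [set (atom true i : B)])))%E.
  apply: le_measure; rewrite ?inE//; first exact: measurableC.
  move=> z nD; have [/atomsP[b [j zE]]|nA] := pselect (atoms z); last by left.
  right; have : ~ D z by [].
  rewrite zE /D/= place_dist_atom; have [->|ji] := eqVneq j i; last by rewrite lexx.
  by case: b {zE} => _; [right|left].
move=> /le_trans; move=> /(_ (0%E + ((mass Q false i)%:E + (mass Q true i)%:E))%E).
rewrite QDC add0e -EFinD lee_fin => H2; suff : 1 - fine (Q D) <= mass Q false i + mass Q true i by lra.
apply: H2; apply: (le_trans (measureU2 _ _ _)) => //.
- exact: measurableC mA.
- exact: measurableU.
rewrite [X in (X + _)%E](QA0) add0e EFinD -!massE.
exact: measureU2.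
Qed.

Lemma sum_mass_tilt x : box x -> budget <= \sum_i mass Q true i * (1 + tilt x i).
Proof.
move=> bx; rewrite -lee_fin -expected_loss_atoms//; first exact: Qopt.
exact: maximizer_concentrated.
Qed.

Lemma sum_mass : \sum_i mass Q true i = budget.
Proof.
have := @expected_loss_atoms R n N Q 0 maximizer_concentrated (@box0 R n).
rewrite /expected_loss; under eq_integral do rewrite lossE.
rewrite integral_rloss0 => -[->]; apply: eq_bigr => i _.
by rewrite tilt0 addr0 mulr1.
Qed.

(** A linear form that is nonnegative on a box symmetric about 0 vanishes there. The j-th unit
    vector scaled by 1/n lies in the box and isolates column j. *)
Lemma mass_balanced j : \sum_i mass Q true i * tilt_coef i j = 0.
Proof.
have bal x : box x -> 0 <= \sum_i mass Q true i * tilt x i.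
  move=> /sum_mass_tilt; under eq_bigr do rewrite mulrDr mulr1.
  by rewrite big_split/= sum_mass lerDl.
pose e : 'rV[R]_n := n%:R^-1 *: delta_mx 0 j.
have n0 : 0 < n%:R^-1 :> R by rewrite invr_gt0 ltr0n.
have be : box e.
  move=> k; rewrite /= in_itv/= !mxE eqxx/=; case: (_ == _); rewrite ?mulr1 ?mulr0.
    by rewrite lexx andbT; lra.
  by apply/andP; split; lra.
have te i : tilt e i = n%:R^-1 * tilt_coef i j.
  rewrite /tilt (bigD1 j)//= big1 ?addr0; first by rewrite !mxE !eqxx mulr1.
  by move=> k /negbTE kj; rewrite !mxE kj andbF mulr0 mul0r.
have h1 := bal _ be; have h2 := bal _ (boxN be).
move: h2; under eq_bigr do rewrite tiltN mulrN.
rewrite sumrN oppr_ge0 => h2.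
have : \sum_i mass Q true i * tilt e i = 0 by apply/eqP; rewrite eq_le h1 h2.
under eq_bigr do rewrite te mulrCA.
by rewrite -mulr_sumr => /eqP; rewrite mulf_eq0 gt_eqF//= => /eqP.
Qed.

Lemma mass_true_le i : mass Q true i <= budget.
Proof.
rewrite -sum_mass (bigD1 i)//= lerDl; apply: sumr_ge0 => k _; exact: mass_ge0.
Qed.

(** The two atoms at place i carry at least 1/N together, the upper one at most [budget] < 1/N. *)
Lemma mass_false_gt0 i : 0 < mass Q false i.
Proof.
have := mass_cluster i; have := mass_true_le i.
have := @budget_lt R n N N_gt0; lra.
Qed.

(** By the balance, each b_i with 1 <= i <= n equals the sum [S] of the b_i outside this range; [S]
    = 0 would make the total 0 instead of [budget]. *)
Lemma mass_true_gt0 :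
  (forall i : 'I_N, (0 < i <= n)%N -> 0 < mass Q true i) /\
  exists2 i : 'I_N, ~~ (0 < i <= n)%N & 0 < mass Q true i.
Proof.
pose S := \sum_(i < N | ~~ (0 < i <= n)%N) mass Q true i.
have ES (i : 'I_N) : (0 < i <= n)%N -> mass Q true i = S.
  (* Columns count from 0, so column i - 1 singles out index i. *)
  move=> /andP[i0 iN]; have jn : (i.-1 < n)%N by lia.
  have jN : ((Ordinal jn).+1 < N)%N by rewrite /= prednK.
  have := mass_balanced (Ordinal jn); rewrite (sum_tilt_coef _ jN) => /eqP.
  rewrite subr_eq0 -/S => /eqP <-; congr (mass Q true _).
  by apply: val_inj; rewrite /= prednK.
have S0 : 0 < S.
  rewrite lt_neqAle sumr_ge0 ?andbT; last by move=> i _; exact: mass_ge0.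
  apply/eqP => S0; have := @budget_gt0 R n N N_gt0.
  rewrite -sum_mass big1 ?ltxx// => i _.
  have [/ES ->//|iO] := boolP (0 < i <= n)%N.
  move/esym/eqP: S0; rewrite /S psumr_eq0 => [/allP/(_ i (mem_index_enum _))|k _].
    by rewrite iO => /eqP.
  exact: mass_ge0.
split=> [i /ES -> //|].
apply/not_exists2P => H; move: S0; rewrite /S big1 ?ltxx// => i iO.
have [//|/negP] := H i; rewrite lt_neqAle mass_ge0 andbT negbK => /eqP; by [].
Qed.

Lemma maximizer_atoms : at_least_atoms (minn (N + n + 1) (2 * N)) Q.
Proof.
have [m1 [i0 i0O m0]] := mass_true_gt0.
(* Numbers below N list the lower atoms, N stands for the upper atom at [i0], and N + i for the
   upper atom at i with 1 <= i <= n; [i0] lies outside this range, so nothing repeats. For k < 2N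
   the default of [insubd] is never reached. *)
pose idx (k : nat) : 'I_N :=
  if (k < N)%N then insubd i0 k else if k == N then i0 else insubd i0 (k - N)%N.
have idxE k : (k < 2 * N)%N ->
    val (idx k) = if (k < N)%N then k else if k == N then val i0 else (k - N)%N.
  rewrite /idx => k2; case: ltnP => kN; first by rewrite val_insubd kN.
  case: eqP => // _; rewrite val_insubd; case: ifP => //; lia.
exists (fun k => atom (N <= k)%N (idx k)); split.
  move=> k l /atom_inj[kl /(congr1 val)]; have := ltn_ord k; have := ltn_ord l.
  rewrite leq_min => /andP[l1 l2]; rewrite leq_min => /andP[k1 k2].
  rewrite !idxE//= => E; apply: val_inj => /=; move: kl i0O E.
  case: (ltnP k N); case: (ltnP l N) => //= lN kN _ i0O.
  by case: (eqVneq (k : nat) N); case: (eqVneq (l : nat) N); lia.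
move=> k; rewrite massE lte_fin; have := ltn_ord k.
rewrite leq_min => /andP[k1 k2]; case: leqP => kN; last exact: mass_false_gt0.
have := idxE _ k2; rewrite ltnNge kN/=; case: eqP => [kE _|kN' iE].
  by rewrite /idx ltnNge kN/= kE eqxx.
by apply: m1; rewrite /= iE; lia.
Qed.

End maximizers.

(** * Regularity of the instance *)

Lemma convex_function_of_le (R : realType) (E : lmodType R) (D : set E)
    (f : E -> R) :
    (forall (t : R) x y, 0 <= t <= 1 ->
      f (t *: x + (1 - t) *: y) <= t * f x + (1 - t) * f y) ->
  convex_function D f.
Proof. by move=> cf t x y _ _; apply: cf; rewrite ge0 le1. Qed.

Section regularity.
Variables (R : realType) (n N : nat).
Hypothesis N_gt0 : (0 < N)%N.
Local Notation V := 'rV[R]_N.+1.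
Local Notation I := (@split_instance R n N).

Lemma affine_piece_affinel (t : R) (x y : 'rV[R]_n) (z : V) :
  affine_piece (t *: x + (1 - t) *: y : 'rV[R]_n) z =
  t * affine_piece x z + (1 - t) * affine_piece y z.
Proof.
have tE (i : 'I_N) : tilt (t *: x + (1 - t) *: y : 'rV[R]_n) i =
    t * tilt x i + (1 - t) * tilt y i.
  rewrite /tilt !mulr_sumr -big_split/=; apply: eq_bigr => j _.
  by rewrite !mxE; ring.
rewrite /affine_piece; under eq_bigr do rewrite tE mulrDr mulrCA [X in _ + X]mulrCA.
by rewrite big_split/= -!mulr_sumr; ring.
Qed.

Lemma affine_piece_affiner (t : R) (x : 'rV[R]_n) (z z' : V) :
  affine_piece x (t *: z + (1 - t) *: z') =
  t * affine_piece x z + (1 - t) * affine_piece x z'.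
Proof.
rewrite /affine_piece {1}/height !mxE.
under eq_bigr do rewrite /place !mxE mulrDl -!mulrA.
by rewrite big_split/= -!mulr_sumr /height /place; ring.
Qed.

Lemma sqr_convex (t a b : R) : 0 <= t <= 1 ->
  (t * a + (1 - t) * b) ^+ 2 <= t * a ^+ 2 + (1 - t) * b ^+ 2.
Proof.
move=> /andP[t0 t1]; rewrite -subr_ge0.
have -> : t * a ^+ 2 + (1 - t) * b ^+ 2 - (t * a + (1 - t) * b) ^+ 2 =
  t * (1 - t) * (a - b) ^+ 2 by ring.
by rewrite mulr_ge0 ?sqr_ge0// mulr_ge0// subr_ge0.
Qed.

Lemma sqdist_convex (z' : V) (D : set V) : convex_function D (@sqdist R N ^~ z').
Proof.
apply: convex_function_of_le => t x y t01.
rewrite /sqdist !mulr_sumr -big_split/=; apply: ler_sum => j _.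
apply: le_trans (sqr_convex _ _ t01); rewrite !mxE le_eqVlt; apply/orP; left.
by apply/eqP; congr (_ ^+ 2); ring.
Qed.

Lemma sqdist_continuous : continuous (fun q : V * V => sqdist q.1 q.2).
Proof.
move=> q; apply: cvg_big => [|j _]; first exact: add_continuous.
have c1 : {for q, continuous (fun q : V * V => q.1 0 j)}.
  by apply: (@continuous_comp _ _ _ fst (fun z : V => z 0 j));
    [exact: cvg_fst|exact: coord_continuous].
have c2 : {for q, continuous (fun q : V * V => q.2 0 j)}.
  by apply: (@continuous_comp _ _ _ snd (fun z : V => z 0 j));
    [exact: cvg_snd|exact: coord_continuous].
by rewrite expr2; under eq_cvg do rewrite expr2; apply: cvgM; apply: cvgB.
Qed.

Lemma sqdist_transport_cost : transport_cost [set: V] (@sqdist R N).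
Proof.
split.
- by move=> z z' _ _; exact: sqdist_ge0.
- move=> q a; rewrite lte_fin => aq.
  have /(_ q) := continuous_subspaceT (A := [set: V] `*` [set: V]) sqdist_continuous.
  move=> /(_ [set y | a < y]) H.
  exists ((fun q : V * V => sqdist q.1 q.2) @^-1` [set y | a < y]).
    by apply: H; exact: lt_nbhsr.
  by move=> y /=; rewrite lte_fin.
- by move=> z _; rewrite /sqdist big1// => j _; rewrite subrr expr0n.
- by move=> z' _; exact: sqdist_convex.
Qed.

(** The norm is the maximum norm, attained at an entry whose square is one of the summands; this
    gives the growth condition with exponent 2. *)
Lemma sqr_norm_le_sqdist (z z' : V) : `|z - z'| ^+ 2 <= sqdist z z'.
Proof.
have [->|nz] := eqVneq `|z - z'| 0; first by rewrite expr0n sqdist_ge0.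
have [[i j] /= E] := mx_norm_neq0 nz.
have -> : `|z - z'| = `|(z - z') i j| by exact: E.
rewrite real_normK ?num_real// /sqdist (bigD1 j)//= !mxE ord1 lerDl.
by apply: sumr_ge0 => k _; exact: sqr_ge0.
Qed.

Lemma box_convex : convex_set (@box R n).
Proof.
move=> x y t; rewrite !inE => bx bY j; have := bx j; have := bY j.
rewrite /= !in_itv/= => /andP[y1 y2] /andP[x1 x2].
have t0 : 0 <= t%:num by exact: ge0.
have t1 : t%:num <= 1 by exact: le1.
have -> : (conv t x y : 'rV[R]_n) ord0 j =
    t%:num * x ord0 j + (1 - t%:num) * y ord0 j.
  by rewrite !mxE.
by apply/andP; split; nra.
Qed.

Lemma box_compact : compact (@box R n).
Proof.
by apply: (@rV_compact R n (fun=> `[- n%:R^-1, n%:R^-1]%classic)) => _;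
  exact: segment_compact.
Qed.

Lemma split_instance_regular : regular I.
Proof.
split.
- split => //; last exact: sqdist_transport_cost.
  by rewrite /= mulr_gt0// budget_gt0.
- split.
  + by exists 0; exact: box0.
  + exact: box_convex.
  + have [Q [aQ EQ]] := feasible_candidate R n N_gt0.
    exists Q, 0; split => //; first exact: box0.
      (* The candidate has constant expected loss on the box, so each sublevel set is the whole
         compact box or empty. *)
      move=> a; have [ba|ab] := leP (budget R n N) a.
        rewrite (_ : [set x | _] = @box R n); first exact: box_compact.
        by apply/seteqP; split => [x []//|x bx]; split => //; rewrite EQ.
      rewrite (_ : [set x | _] = set0); first exact: compact0.
      apply/seteqP; split => // x [bx]; rewrite EQ// lee_fin => /(lt_le_trans ab).
      by rewrite ltxx.
    by rewrite EQ ?ltNyr//; exact: box0.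
  + split; [by exists 0|exact: closedT|by move=> x y t _ _; rewrite inE].
- split => //.
  + move=> k z; apply: convex_function_of_le => t x y _ /=.
    by case: ifP => _; rewrite ?affine_piece_affinel// !mulr0 addr0.
  + move=> k x; apply: convex_function_of_le => t z z' _ /=.
    case: ifP => _; first by rewrite oppr0 !mulr0 addr0.
    by rewrite affine_piece_affiner opprD !mulrN.
- exists (fun z : V => `|z|), 2; split.
  + by split => [u v|a v|v /normr0_eq0//]; rewrite ?ler_normD ?normrZ.
  + by rewrite ler1n.
  + by move=> z z' _ _; rewrite powR_mulrn//; exact: sqr_norm_le_sqdist.
  + by move=> H; exfalso; lra.
Qed.

End regularity.

(** * The optimal value and the support of every maximizer *)

Theorem lemma5 (R : realType) (n N : nat) (hn : (1 <= n)%N) (hN : (3 <= N)%N) :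
  exists I : dro_instance R n N,
    [/\ regular I,
        exists Q, dual_maximizer (I := I) Q
      & forall Q, dual_maximizer (I := I) Q ->
          at_least_atoms (minn (N + n + 1) (npieces I * N)) Q].
Proof.
have N_gt0 : (0 < N)%N by exact: leq_trans hN.
have [Qs [aQs EQs]] := feasible_candidate R n N_gt0.
have objs : dual_objective (I := split_instance R n N) Qs = (budget R n N)%:E.
  rewrite /dual_objective; apply/eqP; rewrite eq_le; apply/andP; split.
    by apply: ereal_inf_lbound; exists 0; [exact: box0|rewrite EQs//; exact: box0].
  by apply/ereal_infP => _ [x bx <-]; rewrite EQs.
exists (split_instance R n N); split; first exact: split_instance_regular.
  (* The decision 0 alone bounds the dual objective of every feasible [Q] by [budget], so the
     candidate is optimal. *)
  exists Qs; split=> // Q aQ; rewrite objs.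
  apply: le_trans (rloss0_bound N_gt0 aQ).
  apply: ereal_inf_lbound; exists 0; first exact: box0.
  by apply: eq_integral => z _; rewrite lossE.
(* A maximizer does at least as well as the candidate, so its expected loss is at least [budget] at
   every decision. *)
move=> Q [aQ mQ]; apply: maximizer_atoms => // x bx.
rewrite -objs; apply: (le_trans (mQ _ aQs)).
by apply: ereal_inf_lbound; exists x.
Qed.
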